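(* Let $T,n,m,N_u$, $\mathbf{W}_1,\mathbf{W}_2,\tilde{\mathbf{D}},\boldsymbol{\Theta},\boldsymbol{\nu}$ and their rows be as in the context, and set $d=T+TN_u$. For symmetric $\mathbf{E}\in\mathbb{R}^{T\times T}$, $\mathbf{L}\in\mathbb{R}^{(n-1)T\times d}$ and real numbers $\lambda_{k,i}$ define, for $i=1,\dots,m$, the row vector $$\boldsymbol{\rho}^i=\tfrac12\Big(\big[\,\mathbf{w}_{1,i}\tilde{\mathbf{D}}^{-1}\mathbf{E},\ -\boldsymbol{\theta}_i\,\big]+\mathbf{w}_{2,i}\mathbf{L}\Big)\in\mathbb{R}^{1\times d}$$ and the block-diagonal matrix $$\mathbf{J}_i=\operatorname{diag}\big(\lambda_{1,i}\mathbf{I}_T,\ \lambda_{2,i}\mathbf{I}_{N_u},\ \dots,\ \lambda_{T+1,i}\mathbf{I}_{N_u}\big)\in\mathbb{R}^{d\times d}.$$ Let $\mathcal{P}$ denote the problem $$\max\ \log\det\mathbf{E}$$ over symmetric $\mathbf{E}\succeq 0$, $\mathbf{e}\in\mathbb{R}^T$, $\mathbf{c}\in\mathbb{R}^{(n-1)T}$, $\mathbf{L}\in\mathbb{R}^{(n-1)T\times d}$, symmetric $\mathbf{Q}_j\in\mathbb{R}^{d\times d}$ ($j=1,\dots,(n-1)T$) and $\lambda_{k,i}\in\mathbb{R}$ ($k=0,\dots,T+1$, $i=1,\dots,m$), subject to, for all $i=1,\dots,m$, $$\sum_{k=0}^{T+1}\lambda_{k,i}+\mathbf{w}_{1,i}\tilde{\mathbf{D}}^{-1}\mathbf{e}+\mathbf{w}_{2,i}\mathbf{c}-\nu_i\le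 0,$$ $$\begin{bmatrix}\lambda_{0,i}&0\\0&\mathbf{J}_i\end{bmatrix}\succeq\begin{bmatrix}0&\boldsymbol{\rho}^i\\(\boldsymbol{\rho}^i)^\top&\sum_{j=1}^{(n-1)T}W_{2,ij}\mathbf{Q}_j\end{bmatrix},$$ $$\lambda_{k,i}\ge 0,\qquad k=0,\dots,T+1.$$ Let $\mathcal{S}$ be the projection of the feasible set of $\mathcal{P}$ on $(\mathbf{E},\mathbf{e})$-space. For $r>0$ let $\mathcal{F}_r$ be the feasible set, projected on $(\mathbf{E},\mathbf{e})$-space, of the robust problem with quadratic policy and norm bound $r$ (as defined in the context). Then the problem $\mathcal{P}$ is a (safe) approximation of the robust problem with quadratic policy and norm bound $1$, with tightness factor at most $9.19\sqrt{\ln(T+1)}$; that is, $$\mathcal{F}_{9.19\sqrt{\ln(T+1)}}\ \subseteq\ \mathcal{S}\ \subseteq\ \mathcal{F}_1 .$$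
   Context: $T,n,m$ are positive integers and $N_u=3$ is the dimension of each uncertainty vector $\boldsymbol{\zeta}_t$. $\|\cdot\|$ is the Euclidean norm, vector inequalities are componentwise, $\mathbf{A}\succeq\mathbf{B}$ means $\mathbf{A}-\mathbf{B}$ is symmetric positive semidefinite, $\mathbf{I}_k$ is the $k\times k$ identity, and $\log\det\mathbf{E}=-\infty$ if $\mathbf{E}$ is singular. Data. $\mathbf{W}\in\mathbb{R}^{m\times nT}$ is a constant matrix; $\mathbf{D}\in\mathbb{R}^{T\times nT}$ is a constant matrix whose $t$-th row has nonzero entries only in columns corresponding to time $t$ and which has rank $T$; $\mathbf{z}(\boldsymbol{\zeta})\in\mathbb{R}^m$ and $\mathbf{b}(\boldsymbol{\zeta})\in\mathbb{R}^T$ are affine functions of $\boldsymbol{\zeta}=(\boldsymbol{\zeta}_1,\dots,\boldsymbol{\zeta}_T)$, $\boldsymbol{\zeta}_t\in\mathbb{R}^{N_u}$. Let $\mathbf{b}^1,\dots,\mathbf{b}^{nT}$ be an orthogonal basis of $\mathbb{R}^{nT}$ with $\mathbf{b}^{T+1},\dots,\mathbf{b}^{nT}$ spanning the null space of $\mathbf{D}$; $\mathbf{B}_1=[\mathbf{b}^1\cdots\mathbf{b}^T]$, $\mathbf{B}_2=[\mathbf{b}^{T+1}\cdots\mathbf{b}^{nT}]$, $\tilde{\mathbf{D}}=\mathbf{D}\mathbf{B}_1$ (nonsingular), $\mathbf{W}_1=\mathbf{W}\mathbf{B}_1\in\mathbb{R}^{m\times T}$, $\mathbf{W}_2=\mathbf{W}\mathbf{B}_2\in\mathbb{R}^{m\times(n-1)T}$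 with entries $W_{2,ij}$. The affine function $\mathbf{u}(\boldsymbol{\zeta})=\mathbf{z}(\boldsymbol{\zeta})+\mathbf{W}_1\tilde{\mathbf{D}}^{-1}\mathbf{b}(\boldsymbol{\zeta})$ is written $\mathbf{u}(\boldsymbol{\zeta})=\boldsymbol{\Theta}\boldsymbol{\zeta}+\boldsymbol{\nu}$ with $\boldsymbol{\Theta}\in\mathbb{R}^{m\times TN_u}$, $\boldsymbol{\nu}\in\mathbb{R}^m$. The $i$-th rows of $\mathbf{W}_1,\mathbf{W}_2,\boldsymbol{\Theta}$ are denoted $\mathbf{w}_{1,i},\mathbf{w}_{2,i},\boldsymbol{\theta}_i$. Robust problem. The underlying adaptive robust problem is to maximize $\log\det\mathbf{E}$ over symmetric $\mathbf{E}\succeq0$, $\mathbf{e}\in\mathbb{R}^T$ such that for all $\boldsymbol{\xi}\in\mathbb{R}^T$ with $\|\boldsymbol{\xi}\|\le1$ and all $\boldsymbol{\zeta}$ with $\|\boldsymbol{\zeta}_t\|\le1$ ($t=1,\dots,T$) there is $\mathbf{y}\in\mathbb{R}^{(n-1)T}$ with $\mathbf{W}_1\tilde{\mathbf{D}}^{-1}(\mathbf{E}\boldsymbol{\xi}+\mathbf{e})+\mathbf{W}_2\mathbf{y}\le\mathbf{u}(\boldsymbol{\zeta})$. Quadratic policy with norm bound $r$. With $\boldsymbol{\eta}=(\boldsymbol{\xi},\boldsymbol{\zeta})\in\mathbb{R}^{d}$, $d=T+TN_u$, the second-stage variable is restricted to the form $\mathbf{y}(\boldsymbol{\eta})=\big(\boldsymbol{\eta}^\top\mathbf{Q}_j\boldsymbol{\eta}\big)_{j=1}^{(n-1)T}+\mathbf{L}\boldsymbol{\eta}+\mathbf{c}$,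 with policy parameters $\mathbf{Q}_j$ (symmetric $d\times d$), $\mathbf{L}$, $\mathbf{c}$ being decision variables. $\mathcal{F}_r$ is the set of $(\mathbf{E},\mathbf{e})$ with $\mathbf{E}\succeq0$ for which there exist $\{\mathbf{Q}_j\},\mathbf{L},\mathbf{c}$ such that $\mathbf{W}_1\tilde{\mathbf{D}}^{-1}(\mathbf{E}\boldsymbol{\xi}+\mathbf{e})+\mathbf{W}_2\mathbf{y}(\boldsymbol{\eta})\le\boldsymbol{\Theta}\boldsymbol{\zeta}+\boldsymbol{\nu}$ for all $\boldsymbol{\eta}=(\boldsymbol{\xi},\boldsymbol{\zeta})$ with $\|\boldsymbol{\xi}\|\le r$ and $\|\boldsymbol{\zeta}_t\|\le r$ for $t=1,\dots,T$. *)

(* Defs.v *)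
From HB Require Import structures.
From mathcomp Require Import all_boot all_order all_algebra.
From mathcomp Require Import all_classical all_reals all_analysis.

Set Implicit Arguments.
Unset Strict Implicit.
Unset Printing Implicit Defensive.
Import Order.TTheory GRing.Theory Num.Theory.

Local Open Scope classical_set_scope.
Local Open Scope ring_scope.

(* The norm that the library puts on 'M[R]_(m, n) is the sup norm. *)
Definition enorm (R : realType) (k : nat) (x : 'cV[R]_k) : R :=
  Num.sqrt (\sum_(i < k) x i 0 ^+ 2).

Definition psd (R : realType) (k : nat) (A : 'M[R]_k) : Prop :=
  A^T = A /\ forall x : 'cV[R]_k, 0 <= (x^T *m A *m x) 0 0.

Definition loewner_ge (R : realType) (k : nat) (A B : 'M[R]_k) : Prop :=
  psd (A - B).

Definition logdet (R : realType) (k : nat) (E : 'M[R]_k) : \bar R :=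
  if E \in unitmx then (ln (\det E))%:E else -oo%E.

Definition affine_map (R : realType) (p q : nat)
    (f : 'cV[R]_p -> 'cV[R]_q) : Prop :=
  exists (A : 'M[R]_(q, p)) (c : 'cV[R]_q), forall x, f x = A *m x + c.

Definition Nu : nat := 3.

(* zeta stacks zeta_1, ..., zeta_T, each of size Nu. *)
Definition zeta_at (R : realType) (T : nat) (zeta : 'cV[R]_(T * Nu)) (t : 'I_T) :
    'cV[R]_Nu :=
  (row t (vec_mx zeta^T))^T.

Record maxProblem (R : realType) (X : Type) := MaxProblem {
  objective : X -> \bar R;
  feasible : set X
}.

(* Parameters of the policy
   y(eta) = (eta^T Q_j eta)_j + L eta + c, with values in R^k. *)
Record policy (R : realType) (d k : nat) := Policy {
  pol_Q : 'I_k -> 'M[R]_d;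
  pol_L : 'M[R]_(k, d);
  pol_c : 'cV[R]_k
}.

Definition policy_sym (R : realType) (d k : nat) (p : policy R d k) : Prop :=
  forall j, (pol_Q p j)^T = pol_Q p j.

Definition policy_eval (R : realType) (d k : nat) (p : policy R d k)
    (eta : 'cV[R]_d) : 'cV[R]_k :=
  (\col_j (eta^T *m pol_Q p j *m eta) 0 0) + pol_L p *m eta + pol_c p.

Definition proj_Ee (R : realType) (T : nat) (Y : Type)
    (P : maxProblem R (('M[R]_T * 'cV[R]_T) * Y)) : set ('M[R]_T * 'cV[R]_T) :=
  fst @` feasible P.

Definition quad_policy_problem (R : realType) (T m k : nat)
    (W1 : 'M[R]_(m, T)) (W2 : 'M[R]_(m, k)) (Dt : 'M[R]_T)
    (Theta : 'M[R]_(m, T * Nu)) (nu : 'cV[R]_m) (r : R) :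
    maxProblem R (('M[R]_T * 'cV[R]_T) * policy R (T + T * Nu) k) :=
  MaxProblem
    (fun v => logdet v.1.1)
    [set v : ('M[R]_T * 'cV[R]_T) * policy R (T + T * Nu) k |
      let: (E, e, p) := v in
      [/\ psd E, policy_sym p
        & forall (xi : 'cV[R]_T) (zeta : 'cV[R]_(T * Nu)),
            enorm xi <= r -> (forall t, enorm (zeta_at zeta t) <= r) ->
            forall i : 'I_m,
              (W1 *m invmx Dt *m (E *m xi + e)
                + W2 *m policy_eval p (col_mx xi zeta)) i 0
              <= (Theta *m zeta + nu) i 0]].

Definition rho (R : realType) (T m k : nat)
    (W1 : 'M[R]_(m, T)) (W2 : 'M[R]_(m, k)) (Dt : 'M[R]_T)
    (Theta : 'M[R]_(m, T * Nu))
    (E : 'M[R]_T) (L : 'M[R]_(k, T + T * Nu)) (i : 'I_m) :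
    'rV[R]_(T + T * Nu) :=
  2^-1 *: (row_mx (row i W1 *m invmx Dt *m E) (- row i Theta)
           + row i W2 *m L).

(* The multipliers lambda_{k,i} form a matrix with rows k = 0, ..., T+1; since
   t : 'I_T counts from 0, the block of zeta_at _ t carries lambda_{t+2,i}. *)
Definition Jmx (R : realType) (T m : nat) (lam : 'M[R]_(T.+2, m)) (i : 'I_m) :
    'M[R]_(T + T * Nu) :=
  block_mx (lam (inord 1) i)%:M 0
           0 (diag_mx (mxvec (\matrix_(t < T, a < Nu) lam (inord t.+2) i))).

Definition sdp_problem (R : realType) (T m k : nat)
    (W1 : 'M[R]_(m, T)) (W2 : 'M[R]_(m, k)) (Dt : 'M[R]_T)
    (Theta : 'M[R]_(m, T * Nu)) (nu : 'cV[R]_m) :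
    maxProblem R (('M[R]_T * 'cV[R]_T)
                  * (policy R (T + T * Nu) k * 'M[R]_(T.+2, m))) :=
  MaxProblem
    (fun v => logdet v.1.1)
    [set v : ('M[R]_T * 'cV[R]_T)
                * (policy R (T + T * Nu) k * 'M[R]_(T.+2, m)) |
      let: (E, e, (p, lam)) := v in
      [/\ psd E, policy_sym p
        & forall i : 'I_m,
          [/\ \sum_(l < T.+2) lam l i
                + (row i W1 *m invmx Dt *m e) 0 0
                + (row i W2 *m pol_c p) 0 0 - nu i 0 <= 0,
              loewner_ge
                (block_mx (lam ord0 i)%:M 0
                          0 (Jmx lam i) : 'M[R]_(1 + (T + T * Nu)))
                (block_mx 0 (rho W1 W2 Dt Theta E (pol_L p) i)
                          (rho W1 W2 Dt Theta E (pol_L p) i)^T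
                          (\sum_(j < k) W2 i j *: pol_Q p j))
            & forall l, 0 <= lam l i]]].

(* Main.v *)
Require Import Defs.
From mathcomp Require Import all_boot all_order all_algebra.
From mathcomp Require Import all_classical all_reals all_analysis.
From mathcomp Require Import ring lra complex.

Set Implicit Arguments.
Unset Strict Implicit.
Unset Printing Implicit Defensive.
Import Order.TTheory GRing.Theory Num.Theory.

Local Open Scope classical_set_scope.
Local Open Scope ring_scope.

(** Write the robust constraint of row i at eta = (xi, zeta) as
    [q(1, eta) <= c], where [q(a, eta) = 2 a rho eta + eta^T Q eta] is the
    homogenized quadratic form and [-c] collects the terms free of eta
    ([policy_constraintE]).

    A feasible point of the semidefinite problem bounds [q(1, eta)] by
    [lambda_0 + lambda_1 |xi|^2 + sum_t lambda_{t+1} |zeta_t|^2], which is at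
    most the sum of the multipliers, hence at most [c], when all the norms are
    at most 1.  This gives the second inclusion ([sdp_sub_quad_policy]).

    The first inclusion is an approximate S-lemma ([approximate_S_lemma]): if
    [q <= c] at all the points whose squared leading coordinate is at most 1
    and whose K = T + 1 blocks have squared norm at most [32 ln (2 K)], then
    the multipliers exist.  Since [32 ln (2 K) <= 64 ln K <= 9.19^2 ln K], the
    radius [9.19 sqrt (ln (T + 1))] is large enough.  The argument has three
    steps.

    Duality.  If the multipliers do not exist, a theorem of the alternative
    for linear functionals on a convex cone ([cone_alternative]) gives a
    positive semidefinite X = Z Z^T with [tr (B X) > c tr_k X] for all k, where
    B is the matrix of q and [tr_k] is the trace over the k-th block.

    Diagonalization.  By the spectral theorem, Z can be multiplied by an
    orthogonal matrix so that its columns z_1, z_2, ... become B-orthogonal;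
    then every combination [x = sum_i eps_i z_i] with signs [eps_i] satisfies
    [q(x) = tr (B X)].

    Rounding ([psd_rounding]).  It remains to choose the signs so that the
    squared norm of each block of x is at most [32 ln (2 K)] times its trace, up
    to an arbitrarily small error, and the square of the leading coordinate at
    most X_00.  Order the columns by decreasing leading coordinate, which may be
    taken nonnegative, and give opposite signs to the two members of each pair
    z_1, z_2, then z_3, z_4, and so on.  The leading coordinate of x is then a
    signed sum of every other gap of a decreasing sequence, so its absolute
    value is at most the first term, whatever the signs given to the pairs.
    The differences z_1 - z_2, z_3 - z_4, ... have at most twice the variance,
    and exponential moments of the squared coordinates, handled by the method
    of conditional expectations ([signed_sum_small_estimators]), provide signs
    for the pairs that are good for the K blocks simultaneously. *)

(** * A theorem of the alternative for convex cones *)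

(** The planar case of the alternative: with [t = b / (1 + b)], every point of
    the cone where v is negative forces a lower bound on the multiplier b, every
    point where v is positive an upper bound.  A lower bound above an upper
    bound would yield, by combining the two points, a point of the cone where v
    vanishes and u is positive; so the supremum of the lower bounds is
    suitable. *)
Lemma two_functionals_alternative (R : realType) (V : lmodType R) (C : set V)
    (u v : V -> R) :
  (forall x y, C x -> C y -> C (x + y)) ->
  (forall a x, 0 < a -> C x -> C (a *: x)) ->
  (forall x y, u (x + y) = u x + u y) -> (forall a x, u (a *: x) = a * u x) ->
  (forall x y, v (x + y) = v x + v y) -> (forall a x, v (a *: x) = a * v x) ->
  (forall x, C x -> 0 < v x -> u x <= 0) ->
  exists2 t, 0 <= t <= 1 & forall x, C x -> (1 - t) * u x + t * v x <= 0.
Proof.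
move=> CD CZ uD uZ vD vZ uv.
have [vle0|] := pselect (forall x, C x -> v x <= 0).
  exists 1; first by rewrite ler01 lexx.
  by move=> x Cx; rewrite subrr mul0r add0r mul1r vle0.
move=> /existsNP[x1 /not_implyP[Cx1 /negP]]; rewrite -ltNge => vx1.
(* where v vanishes, u <= 0: otherwise adding x1 to a large multiple of x makes
   both u and v positive *)
have uv0 x : C x -> 0 <= v x -> u x <= 0.
  move=> Cx; rewrite le_eqVlt => /orP[/eqP v0|/uv]; last exact.
  rewrite leNgt; apply/negP => ux.
  have a0 : 0 < (1 - u x1) / u x.
    by rewrite divr_gt0// subr_gt0 (le_lt_trans (uv _ Cx1 vx1)).
  have := uv _ (CD _ _ (CZ _ _ a0 Cx) Cx1).
  rewrite uD uZ vD vZ -v0 mulr0 add0r => /(_ vx1).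
  by rewrite divfK ?gt_eqF// subrK ler10.
(* the lower bounds on the multiplier, and 0 *)
pose S := [set b : R | b = 0 \/ exists2 x, C x /\ v x < 0 & b = u x / - v x].
have Sub b x : S b -> C x -> 0 < v x -> b <= - u x / v x.
  move=> [-> Cx vx|[y [Cy vy] -> Cx vx]].
    by rewrite divr_ge0 ?oppr_ge0 ?uv// ltW.
  rewrite ler_pdivrMr ?oppr_gt0// mulrAC ler_pdivlMr//.
  have Nvy : 0 < - v y by rewrite oppr_gt0.
  have := uv0 _ (CD _ _ (CZ _ _ vx Cy) (CZ _ _ Nvy Cx)).
  rewrite uD !uZ vD !vZ mulNr [v y * _]mulrC subrr lexx => /(_ isT).
  by lra.
have hS : has_sup S.
  split; first by exists 0; left.
  by exists (- u x1 / v x1) => b Sb; exact: Sub.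
have b0 : 0 <= sup S by apply: ub_le_sup; [case: hS|left].
have b1 : 0 < 1 + sup S by rewrite ltr_pwDl.
exists (sup S / (1 + sup S)).
  by rewrite divr_ge0 ?(ltW b1)//= ler_pdivrMr// mul1r lerDr ler01.
move=> x Cx.
have -> : (1 - sup S / (1 + sup S)) * u x + sup S / (1 + sup S) * v x
          = (1 + sup S)^-1 * (u x + sup S * v x) by field; rewrite gt_eqF.
rewrite pmulr_rle0 ?invr_gt0//.
have [vx|vx|vx] := ltgtP (v x) 0.
- have : u x / - v x <= sup S by apply: ub_le_sup; [case: hS|right; exists x].
  by rewrite ler_pdivrMr ?oppr_gt0//; lra.
- have : sup S <= - u x / v x.
    by apply: ge_sup; [case: hS|move=> b Sb; exact: Sub].
  by rewrite ler_pdivlMr//; lra.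
- by rewrite vx mulr0 addr0 uv0// vx.
Qed.

(** By induction on the number of functionals: on the part of the cone where the
    last one is positive, the others already have a nonpositive convex
    combination u, and the planar case combines u with the last one. *)
Lemma cone_alternative_nat (R : realType) (V : lmodType R) (v : nat -> V -> R)
    (N : nat) (C : set V) :
  (forall x y, C x -> C y -> C (x + y)) ->
  (forall a x, 0 < a -> C x -> C (a *: x)) ->
  (forall i x y, v i (x + y) = v i x + v i y) ->
  (forall i a x, v i (a *: x) = a * v i x) ->
  (forall x, C x -> exists2 i, (i <= N)%N & v i x <= 0) ->
  exists2 l : nat -> R, (forall i, 0 <= l i) /\ \sum_(i < N.+1) l i = 1 &
    forall x, C x -> \sum_(i < N.+1) l i * v i x <= 0.
Proof.
move=> CD CZ vD vZ; elim: N C CD CZ => [|N IH] C CD CZ H.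
  exists (fun=> 1); first by split; rewrite ?big_ord1.
  move=> x Cx; rewrite big_ord1 mul1r.
  by have [k] := H x Cx; rewrite leqn0 => /eqP ->.
have [| | |l [l0 l1] lP] := IH [set x | C x /\ 0 < v N.+1 x].
- move=> x y [Cx vx] [Cy vy]; split; first exact: CD.
  by rewrite vD addr_gt0.
- move=> a x a0 [Cx vx]; split; first exact: CZ.
  by rewrite vZ mulr_gt0.
- move=> x [Cx vx]; have [k] := H x Cx.
  rewrite leq_eqVlt => /orP[/eqP ->|kN vk]; first by rewrite leNgt vx.
  by exists k.
have [//|//| | |//|//| |t /andP[t0 t1] tP] :=
  @two_functionals_alternative _ _ C (fun x => \sum_(i < N.+1) l i * v i x)
    (v N.+1).
- by move=> x y; rewrite -big_split/=; apply: eq_bigr => i _; rewrite vD mulrDr.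
- by move=> a x; rewrite mulr_sumr; apply: eq_bigr => i _; rewrite vZ mulrCA.
- by move=> x Cx vx; exact: lP.
exists (fun i => if (i < N.+1)%N then (1 - t) * l i else t).
  split; first by move=> i; case: ifP => // _; rewrite mulr_ge0// subr_ge0.
  rewrite big_ord_recr/= ltnn; under eq_bigr => i _ do rewrite ltn_ord.
  by rewrite -mulr_sumr l1 mulr1 subrK.
move=> x Cx; rewrite big_ord_recr/= ltnn.
under eq_bigr => i _ do rewrite ltn_ord -mulrA.
by rewrite -mulr_sumr tP.
Qed.

(** For the cone of the matrices X = Z Z^T and the functionals
    [tr (B X) - c tr_k X], this is the strong duality of the semidefinite
    problem, together with the existence of optimal multipliers. *)
Lemma cone_alternative (R : realType) (V : lmodType R) (I : finType)
    (v : I -> V -> R) (C : set V) :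
  (0 < #|I|)%N ->
  (forall x y, C x -> C y -> C (x + y)) ->
  (forall a x, 0 < a -> C x -> C (a *: x)) ->
  (forall i x y, v i (x + y) = v i x + v i y) ->
  (forall i a x, v i (a *: x) = a * v i x) ->
  (forall x, C x -> exists i, v i x <= 0) ->
  exists2 l : I -> R, (forall i, 0 <= l i) /\ \sum_i l i = 1 &
    forall x, C x -> \sum_i l i * v i x <= 0.
Proof.
move=> /card_gt0P[i0 _] CD CZ vD vZ H.
have sz : (size (enum I)).-1.+1 = size (enum I).
  by rewrite prednK// -cardT; apply/card_gt0P; exists i0.
have [| | |l [l0 l1] lP] := @cone_alternative_nat _ _
    (fun i => v (nth i0 (enum I) i)) (size (enum I)).-1 C CD CZ.
- by move=> i x y; exact: vD.
- by move=> i a x; exact: vZ.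
- move=> x Cx; have [i vi] := H x Cx; exists (index i (enum I)).
    by rewrite -ltnS sz index_mem mem_enum.
  by rewrite nth_index// mem_enum.
have sumE (F : I -> nat -> R) : \sum_i F i (index i (enum I)) =
    \sum_(i < (size (enum I)).-1.+1) F (nth i0 (enum I) i) i.
  rewrite sz -big_enum (big_nth i0) big_mkord; apply: eq_bigr => i _.
  by rewrite index_uniq// enum_uniq.
exists (fun i => l (index i (enum I))).
  by split=> //; rewrite (sumE (fun _ => l)).
by move=> x Cx; rewrite (sumE (fun i n => l n * v i x)) lP.
Qed.

(** * The spectral theorem for real symmetric matrices *)

(** Over the complex numbers the matrix is Hermitian, so it has a real
    eigenvalue; being a root of the characteristic polynomial, this eigenvalue
    has an eigenvector over the base field too. *)
Lemma symmetric_has_eigenvector (R : rcfType) (n : nat) (A : 'M[R]_n.+1) :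
  A^T = A -> exists (a : R) (u : 'rV[R]_n.+1), u != 0 /\ u *m A = a *: u.
Proof.
move=> symA; pose C : numClosedFieldType := R[i].
pose f : {rmorphism R -> C} := real_complex R.
pose A' : 'M[C]_n.+1 := map_mx f A.
have hA : A' \is hermsymmx.
  apply: realsym_hermsym.
    by apply/is_hermitianmxP; rewrite expr0 scale1r map_mx_id// /A' map_trmx symA.
  apply/mxOverP => i j; rewrite mxE; apply/complex_realP.
  by exists (A i j).
have /mxOverP/(_ 0 0)/complex_realP[a aE] := hermitian_spectral_diag_real hA.
have /orthomx_spectralP AE := hermitian_normalmx hA.
have : eigenvalue A' (f a).
  apply/eigenvalueP; exists (row 0 (spectralmx A')).
    rewrite -row_mul {2}AE !mulmxA mulmxV ?spectral_unit// mul1mx.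
    by rewrite row_mul row_diag_mx -scalemxAl -rowE aE.
  apply/eqP => r0; have := spectral_unit A'.
  rewrite -row_free_unit => /row_freeP[X XE].
  have := congr1 (row 0) XE; rewrite row_mul r0 mul0mx => /rowP/(_ 0).
  by rewrite !mxE eqxx => /eqP; rewrite eq_sym oner_eq0.
rewrite eigenvalue_root_char -map_char_poly fmorph_root -eigenvalue_root_char.
by move=> /eigenvalueP[u ua u0]; exists a, u.
Qed.

(** The Householder reflection in the hyperplane orthogonal to u - e_0. *)
Lemma reflection_to_basis_vector (R : realFieldType) (n : nat)
    (u : 'rV[R]_n.+1) :
  u *m u^T = 1%:M ->
  exists H : 'M[R]_n.+1,
    [/\ H^T = H, H *m H = 1%:M & u *m H = delta_mx 0 0].
Proof.
move=> uu; have [->|ue] := eqVneq u (delta_mx 0 0).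
  by exists 1%:M; rewrite trmx1 !mulmx1.
pose e : 'rV[R]_n.+1 := delta_mx 0 0; pose v := u - e.
have uv : u *m v^T = (1 - u 0 0)%:M.
  rewrite /v [(u - e)^T]raddfB/= mulmxBr uu trmx_delta [RHS]raddfB/=; congr (_ - _).
  by rewrite -colE [LHS]mx11_scalar mxE.
have vv : v *m v^T = (2 * (1 - u 0 0))%:M.
  rewrite {1}/v mulmxBl uv /v [(u - e)^T]raddfB/= mulmxBr trmx_delta -!rowE.
  rewrite [X in _ - X]mx11_scalar !mxE !eqxx /= -raddfB/=.
  by congr (_%:M); ring.
have a0 : 2 * (1 - u 0 0) != 0.
  apply: contra_neq ue => a0; apply/subr0_eq/rowP => j.
  have : (v *m v^T) 0 0 == 0 by rewrite vv a0 mxE mul0rn.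
  rewrite mxE psumr_eq0 => [/allP/(_ j)|i _]; last first.
    by rewrite [v^T _ _]mxE -expr2 sqr_ge0.
  rewrite mem_index_enum => /(_ isT); rewrite [v^T _ _]mxE mulf_eq0 orbb.
  by move=> /eqP vj; rewrite [RHS]mxE.
pose a := 2 * (1 - u 0 0); pose P := v^T *m v.
have PP : P *m P = a *: P.
  by rewrite /P mulmxA -(mulmxA v^T) vv -/a mul_mx_scalar -scalemxAl.
exists (1%:M - (2 / a) *: P); split.
- by rewrite raddfB/= trmx1 linearZ/= trmx_mul trmxK.
- have bPbP : ((2 / a) *: P) *m ((2 / a) *: P) = (2 / a) *: P + (2 / a) *: P.
    by rewrite -scalemxAl -scalemxAr PP !scalerA -scalerDl; congr (_ *: _); field.
  rewrite mulmxBr mulmx1 mulmxBl mul1mx bPbP.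
  by rewrite opprB addrK subrK.
- rewrite mulmxBr mulmx1 -scalemxAr mulmxA uv mul_scalar_mx scalerA.
  rewrite (_ : _ * _ = 1) ?scale1r ?subKr// /a.
  by field; move: a0; rewrite mulf_eq0 negb_or => /andP[].
Qed.

(** By induction on the dimension: a reflection H that carries a unit eigenvector
    to e_0 makes e_0 an eigenvector of H A H, whose first row and column
    then vanish off the diagonal. *)
Lemma symmetric_orthogonally_diagonalizable (R : rcfType) (n : nat)
    (A : 'M[R]_n) :
  A^T = A -> exists2 P : 'M[R]_n, P *m P^T = 1%:M & is_diag_mx (P *m A *m P^T).
Proof.
elim: n A => [|n IH] A symA.
  by exists 1%:M; rewrite ?trmx1 ?mulmx1//; apply/is_diag_mxP => -[].
have [a [u0 [u0N u0A]]] := symmetric_has_eigenvector symA.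
have s0 : 0 < (u0 *m u0^T) 0 0.
  rewrite mxE lt_neqAle eq_sym; apply/andP; split; last first.
    by apply: sumr_ge0 => i _; rewrite mxE -expr2 sqr_ge0.
  apply: contraNneq u0N => /eqP.
  rewrite psumr_eq0 => [/allP z|i _]; last by rewrite mxE -expr2 sqr_ge0.
  apply/eqP/rowP => j; have := z j; rewrite mem_index_enum => /(_ isT) /=.
  by rewrite !mxE mulf_eq0 orbb => /eqP.
pose u := (Num.sqrt ((u0 *m u0^T) 0 0))^-1 *: u0.
have uu : u *m u^T = 1%:M.
  rewrite /u linearZ/= -scalemxAl -scalemxAr scalerA -invfM -expr2.
  rewrite sqr_sqrtr ?ltW//; set c := (u0 *m u0^T) 0 0.
  by rewrite [u0 *m _]mx11_scalar -/c scale_scalar_mx mulVf ?gt_eqF.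
have [H [HT HH uH]] := reflection_to_basis_vector uu.
have eH : delta_mx 0 0 *m H = u by rewrite -uH -mulmxA HH mulmx1.
have [G GH] : {G : 'M[R]_(1 + n) | G = H *m A *m H} by exists (H *m A *m H).
have GT : G^T = G by rewrite GH !trmx_mul HT symA mulmxA.
have G0 : row 0 G = a *: delta_mx 0 0.
  rewrite rowE GH !mulmxA eH /u -scalemxAl u0A scalerA mulrC -scalerA -/u.
  by rewrite -scalemxAl uH.
have GE : G = block_mx a%:M 0 0 (drsubmx G).
  have ur : ursubmx G = 0.
    apply/matrixP => i j; have /rowP/(_ (rshift 1 j)) := G0.
    by rewrite !mxE !ord1 /= mulr0 => <-; congr (G _ _); apply/val_inj.
  have dl : dlsubmx G = 0 by rewrite -GT -trmx_ursub ur trmx0.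
  rewrite -[LHS]submxK ur dl; congr block_mx.
  rewrite [ulsubmx G]mx11_scalar; congr (_%:M).
  have /rowP/(_ 0) := G0; rewrite !mxE eqxx mulr1 => <-.
  by congr (G _ _); apply/val_inj.
have [|P1 P1P P1d] := IH (drsubmx G); first by rewrite trmx_drsub GT.
pose Q : 'M[R]_(1 + n) := block_mx 1%:M 0 0 P1.
have QQ : Q *m Q^T = 1%:M.
  rewrite tr_block_mx mulmx_block !trmx0 !mulmx0 !mul0mx trmx1 mulmx1.
  by rewrite addr0 !add0r P1P -scalar_mx_block.
have QGQ : is_diag_mx (Q *m G *m Q^T).
  rewrite GE tr_block_mx !mulmx_block !trmx0 trmx1.
  rewrite !(mulmx0, mul0mx, mulmx1, mul1mx, addr0, add0r).
  by rewrite is_diag_block_mx// !eqxx mx11_is_diag.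
exists (Q *m H); rewrite trmx_mul HT mulmxA.
  by rewrite -(mulmxA _ H H) HH mulmx1.
by rewrite -(mulmxA _ H A) -(mulmxA _ _ H) -GH.
Qed.

(** * Signed sums with small coordinates *)

(** Twice the hyperbolic cosine.  The optimal exponent is y^2 / 2; the larger
    one has a short proof, by [exp z <= 1 / (1 - z)] when |y| is at most 1/2 and
    by [|y| <= 2 y^2] otherwise. *)
Lemma expRD_le_gaussian (R : realType) (y : R) :
  expR y + expR (- y) <= 2 * expR (2 * y ^+ 2).
Proof.
have [y2|y2] := leP (y ^+ 2) (4^-1); last first.
  suff le2 (z : R) : z ^+ 2 = y ^+ 2 -> expR z <= expR (2 * y ^+ 2).
    have := le2 y erefl; have := le2 (- y) (sqrrN y); lra.
  by move=> zy; rewrite ler_expR -zy; nra.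
have : 1 - y <= expR (- y) by have := expR_ge1Dx (- y); lra.
have : 1 + y <= expR y by exact: expR_ge1Dx.
have : 1 + 2 * y ^+ 2 <= expR (2 * y ^+ 2) by exact: expR_ge1Dx.
have y0 := expR_gt0 y; have y1 := expR_gt0 (- y).
have : expR y * expR (- y) = 1 by rewrite -expRD subrr expR0.
move: (expR y) (expR (- y)) (expR (2 * y ^+ 2)) y0 y1 => a b c a0 b0 ab hc ha hb.
have ? : - (2^-1) <= y <= 2^-1 by apply/andP; split; nra.
have a1 : a * (1 - y) <= a * b by apply: ler_wpM2l => //; exact: ltW.
have b1 : b * (1 + y) <= b * a by apply: ler_wpM2l => //; exact: ltW.
rewrite [b * a]mulrC ab in b1; rewrite ab in a1.
have ab2 : (a + b) * (1 - y ^+ 2) <= 2.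
  have -> : (a + b) * (1 - y ^+ 2) =
    a * (1 - y) * (1 + y) + b * (1 + y) * (1 - y) by ring.
  have : a * (1 - y) * (1 + y) <= 1 * (1 + y) by apply: ler_wpM2r => //; lra.
  have : b * (1 + y) * (1 - y) <= 1 * (1 - y) by apply: ler_wpM2r => //; lra.
  lra.
have y20 := sqr_ge0 y.
have : (a + b) * (1 - y ^+ 2) <= 2 * c * (1 - y ^+ 2) by nra.
by rewrite ler_pM2r//; lra.
Qed.

(** Let c be the part of a random signed sum x whose signs are already chosen,
    and u be U minus 8 times the variance still to come.  Then [estimator u c]
    is an upper bound of the conditional expectation of [estimator U x], that
    is, of a multiple of [exp (x^2 / U)]. *)
Definition estimator (R : realType) (u c : R) : R := u^-1 * expR (c ^+ 2 / u).

(** Adding a term w with a random sign does not increase the estimator on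
    average, provided that 8 w^2 is released from the reserve.  The mixed term
    of the squares is absorbed by the bound on the hyperbolic cosine, with
    [y = 2 c w / u'], and the factor [exp (w^2 / u')] by the growth of the
    prefactor from 1 / u' to 1 / u. *)
Lemma estimator_average (R : realType) (u c w : R) : 0 < u ->
  estimator (u + 8 * w ^+ 2) (c + w) + estimator (u + 8 * w ^+ 2) (c - w)
    <= 2 * estimator u c.
Proof.
move=> u0; rewrite /estimator.
have w0 := sqr_ge0 w.
have [u' u'E] : {u' | u' = u + 8 * w ^+ 2} by exists (u + 8 * w ^+ 2).
rewrite -u'E; have u'0 : 0 < u' by lra.
have u'N : u' != 0 by rewrite gt_eqF.
pose y := 2 * c * w / u'.
have -> : (c + w) ^+ 2 / u' = c ^+ 2 / u' + w ^+ 2 / u' + y by rewrite /y; field.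
have -> : (c - w) ^+ 2 / u' = c ^+ 2 / u' + w ^+ 2 / u' + - y by rewrite /y; field.
rewrite -mulrDr 2![expR (_ + _ / _ + _)]expRD -mulrDr.
rewrite [expR (_ + _)]expRD.
have yE : expR (c ^+ 2 / u') * (expR y + expR (- y)) <= 2 * expR (c ^+ 2 / u).
  apply: (@le_trans _ _ (2 * (expR (c ^+ 2 / u') * expR (2 * y ^+ 2)))).
    by rewrite [leRHS]mulrCA ler_wpM2l ?expR_ge0// expRD_le_gaussian.
  rewrite ler_wpM2l// -expRD ler_expR /y.
  have -> : c ^+ 2 / u' + 2 * (2 * c * w / u') ^+ 2
          = c ^+ 2 * ((u' + 8 * w ^+ 2) / u' ^+ 2) by field.
  rewrite ler_wpM2l ?sqr_ge0// ler_pdivrMr ?exprn_gt0// [u^-1 * _]mulrC ler_pdivlMr//.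
  by rewrite u'E; nra.
have uw : u'^-1 * expR (w ^+ 2 / u') <= u^-1.
  have := expR_ge1Dx (- (w ^+ 2 / u')); rewrite expRN => H.
  have H1 : u / u' <= (expR (w ^+ 2 / u'))^-1.
    apply: le_trans H; rewrite ler_pdivrMr// mulrDl mul1r mulNr divfK//.
    by rewrite u'E; nra.
  rewrite mulrC ler_pdivrMr// -[leLHS]invrK -[leRHS]invrK lef_pV2 ?posrE; last 2 first.
  - by rewrite invr_gt0 expR_gt0.
  - by rewrite invr_gt0 mulr_gt0// invr_gt0.
  by rewrite invfM invrK.
rewrite (_ : u'^-1 * _ = (u'^-1 * expR (w ^+ 2 / u')) *
  (expR (c ^+ 2 / u') * (expR y + expR (- y)))); last by ring.
rewrite [leRHS]mulrCA ler_pM//.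
by rewrite mulr_ge0 ?invr_ge0 ?expR_ge0// ltW.
Qed.

Fixpoint signed_sums (V : zmodType) (c : V) (s : seq V) : set V :=
  if s is w :: s' then signed_sums (c + w) s' `|` signed_sums (c - w) s'
  else [set c].

(** The method of conditional expectations: at each step at least one of the two
    signs does not increase the weighted sum of the estimators, so no
    probability space is needed. *)
Lemma signed_sum_small_estimators (R : realType) (n : nat) (p : 'I_n -> R)
    (s : seq 'cV[R]_n) (u : 'I_n -> R) (c : 'cV[R]_n) :
  (forall j, 0 <= p j) -> (forall j, 0 < u j) ->
  exists2 x, signed_sums c s x &
    \sum_j p j * estimator (u j + 8 * \sum_(w <- s) w j 0 ^+ 2) (x j 0)
      <= \sum_j p j * estimator (u j) (c j 0).
Proof.
move=> p0; elim: s u c => [|w s IH] u c u0 /=.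
  by exists c => //; under eq_bigr => j _ do rewrite big_nil mulr0 addr0.
pose u' j := u j + 8 * w j 0 ^+ 2.
have u'0 j : 0 < u' j by rewrite ltr_wpDr// mulr_ge0// sqr_ge0.
have [x1 x1s x1P] := IH u' (c + w) u'0; have [x2 x2s x2P] := IH u' (c - w) u'0.
have avg : \sum_j p j * estimator (u' j) ((c + w) j 0) +
    \sum_j p j * estimator (u' j) ((c - w) j 0)
    <= 2 * \sum_j p j * estimator (u j) (c j 0).
  rewrite -big_split mulr_sumr/=; apply: ler_sum => j _.
  by rewrite !mxE -mulrDr mulrCA ler_wpM2l// estimator_average.
have sE (x : 'cV[R]_n) :
    \sum_j p j * estimator (u j + 8 * \sum_(v <- w :: s) v j 0 ^+ 2) (x j 0)
    = \sum_j p j * estimator (u' j + 8 * \sum_(v <- s) v j 0 ^+ 2) (x j 0).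
  by apply: eq_bigr => j _; rewrite big_cons mulrDr addrA.
have [le12|/ltW le21] := leP (\sum_j p j * estimator (u' j) ((c + w) j 0))
  (\sum_j p j * estimator (u' j) ((c - w) j 0)).
- by exists x1; [left|rewrite sE; apply: le_trans x1P _; lra].
- by exists x2; [right|rewrite sE; apply: le_trans x2P _; lra].
Qed.

Lemma expR_jensen (R : realType) (I : finType) (A : {set I}) (p y : I -> R) :
  (forall i, 0 <= p i) -> \sum_(i in A) p i = 1 ->
  expR (\sum_(i in A) p i * y i) <= \sum_(i in A) p i * expR (y i).
Proof.
move=> p0 p1; set m := \sum_(i in A) p i * y i.
have : expR m * (\sum_(i in A) p i * (1 + (y i - m))) <= \sum_(i in A) p i * expR (y i).
  rewrite mulr_sumr; apply: ler_sum => i _.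
  have -> : expR (y i) = expR m * expR (y i - m) by rewrite -expRD addrC subrK.
  by rewrite mulrCA !ler_wpM2l ?expR_ge0 ?expR_ge1Dx.
rewrite (_ : \sum_(i in A) p i * (1 + (y i - m)) = 1) ?mulr1//.
under eq_bigr => i _ do rewrite addrA mulrBr mulrDr mulr1.
by rewrite sumrB big_split/= -mulr_suml p1 mul1r -/m addrK.
Qed.

(** * Signing in pairs *)

(** Signing the differences of consecutive terms amounts to giving opposite signs
    to the two members of each pair. *)
Fixpoint pair_diffs (V : zmodType) (s : seq V) : seq V :=
  if s is x :: y :: s' then x - y :: pair_diffs s' else s.

Lemma pair_ind (A : Type) (P : seq A -> Prop) :
  P [::] -> (forall x, P [:: x]) ->
  (forall x y s, P s -> P [:: x, y & s]) -> forall s, P s.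
Proof.
move=> P0 P1 P2; fix IH 1 => -[//|x [//|y s]]; exact/P2/IH.
Qed.

Lemma signed_sums_pair_diffs (V : zmodType) (c : V) (s : seq V) :
  signed_sums c (pair_diffs s) `<=` signed_sums c s.
Proof.
move: c; elim/pair_ind: s => [|x|x y s IH] c v //= [vs|vs].
  by left; right; apply: IH; rewrite -addrA.
by right; left; apply: IH; rewrite -addrA [- x + y]addrC -opprB.
Qed.

Lemma signed_sums_norm (R : realDomainType) (V : zmodType) (h : V -> R)
    (s : seq V) (c x : V) :
  {morph h : v w / v + w} -> {morph h : v w / v - w} ->
  signed_sums c s x -> `|h x| <= `|h c| + \sum_(w <- s) `|h w|.
Proof.
move=> hD hB; elim: s c => [|w s IH] c /=.
  by move=> ->; rewrite big_nil addr0.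
rewrite big_cons addrA => -[]/IH /le_trans; apply; rewrite lerD2r.
  by rewrite hD ler_normD.
by rewrite hB ler_normB.
Qed.

(** The gaps between the members of the pairs are the lengths of nonoverlapping
    intervals between 0 and m. *)
Lemma pair_diffs_telescope (R : realDomainType) (V : zmodType)
    (h : V -> R) (s : seq V) (m : R) :
  {morph h : v w / v - w} -> 0 <= m -> path >=%R m (map h s) ->
  all (fun z => 0 <= h z) s ->
  \sum_(w <- pair_diffs s) `|h w| <= m.
Proof.
move=> hB; move: m; elim/pair_ind: s => [|z|x y s IH] m m0 /=; first by rewrite big_nil.
  by rewrite big_seq1 andbT => mz /andP[z0 _]; rewrite ger0_norm.
move=> /and3P[mx xy yp] /and3P[x0 y0 s0]; rewrite big_cons hB ger0_norm.
  by apply: le_trans mx; rewrite -lerBrDl subKr IH.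
by rewrite subr_ge0.
Qed.

Lemma pair_diffs_sqr (R : realDomainType) (V : zmodType)
    (h : V -> R) (s : seq V) :
  {morph h : v w / v - w} ->
  \sum_(w <- pair_diffs s) h w ^+ 2 <= 2 * \sum_(z <- s) h z ^+ 2.
Proof.
move=> hB; elim/pair_ind: s => [|z|x y s IH] /=.
  by rewrite !big_nil mulr0.
  by rewrite !big_seq1; have := sqr_ge0 (h z); lra.
rewrite !big_cons hB; have := sqr_ge0 (h x + h y); nra.
Qed.

(** * Quadratic forms on signed sums *)

Definition bilin (R : realType) (n : nat) (B : 'M[R]_n) (x y : 'cV[R]_n) : R :=
  (x^T *m B *m y) 0 0.

Lemma bilinDl (R : realType) (n : nat) (B : 'M[R]_n) (x y z : 'cV[R]_n) :
  bilin B (x + y) z = bilin B x z + bilin B y z.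
Proof. by rewrite /bilin [(x + y)^T]raddfD/= !mulmxDl mxE. Qed.

Lemma bilinC (R : realType) (n : nat) (B : 'M[R]_n) (x y : 'cV[R]_n) :
  B^T = B -> bilin B x y = bilin B y x.
Proof.
move=> BT; rewrite /bilin -[in RHS](trmxK (_ *m B *m x)) [RHS]mxE.
by rewrite !trmx_mul trmxK BT mulmxA.
Qed.

Lemma bilinNl (R : realType) (n : nat) (B : 'M[R]_n) (x y : 'cV[R]_n) :
  bilin B (- x) y = - bilin B x y.
Proof. by rewrite /bilin [(- x)^T]raddfN/= !mulNmx mxE. Qed.

Lemma bilinNN (R : realType) (n : nat) (B : 'M[R]_n) (x y : 'cV[R]_n) :
  bilin B (- x) (- y) = bilin B x y.
Proof. by rewrite bilinNl /bilin mulmxN mxE opprK. Qed.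

Lemma bilinZZ (R : realType) (n : nat) (B : 'M[R]_n) (a : R) (x : 'cV[R]_n) :
  bilin B (a *: x) (a *: x) = a ^+ 2 * bilin B x x.
Proof.
rewrite /bilin [(a *: x)^T]linearZ/= -!scalemxAl -scalemxAr scalerA -expr2.
by rewrite [LHS]mxE.
Qed.

(** For vectors that are pairwise B-orthogonal, the quadratic form of a signed sum
    is independent of the signs: this is what makes it possible to keep the
    value of q exactly while choosing the signs for the sake of the blocks. *)
Lemma bilin_signed_sums (R : realType) (n : nat) (B : 'M[R]_n) (s : seq 'cV[R]_n)
    (c x : 'cV[R]_n) :
  B^T = B -> all (fun w => bilin B c w == 0) s ->
  pairwise (fun v w => bilin B v w == 0) s -> signed_sums c s x ->
  bilin B x x = bilin B c c + \sum_(w <- s) bilin B w w.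
Proof.
move=> BT; elim: s c => [|w s IH] c /=.
  by move=> _ _ ->; rewrite big_nil addr0.
move=> /andP[/eqP cw cs] /andP[ws ss].
have sq v : bilin B c v = 0 -> bilin B (c + v) (c + v) = bilin B c c + bilin B v v.
  move=> cv; rewrite bilinDl bilinC// bilinDl [X in _ + X]bilinC// bilinDl.
  by rewrite [bilin B v c]bilinC// cv addr0 add0r.
have ort v : all (fun z => bilin B v z == 0) s ->
    all (fun z => bilin B (c + v) z == 0) s.
  move=> /allP vs; apply/allP => z zs.
  by rewrite bilinDl (eqP (vs _ zs)) addr0 (allP cs).
rewrite big_cons addrA => -[]/(IH _ _ ss) -> //.
- by rewrite sq.
- exact: ort.
- by rewrite sq ?bilinNN// bilinC// bilinNl bilinC// cw oppr0.
- apply: ort; apply/allP => z /(allP ws) /eqP wz.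
  by rewrite bilinNl wz oppr0.
Qed.

(** * Rounding a positive semidefinite matrix *)

(** The estimators are started with [U_j = 32 o_j].  The terms of s use up at most
    [8 * 2 o_j], half of it, so that the exponential moment of each coordinate
    is at most 2.  Within a block, Jensen's inequality with weights
    [o_j / O_k] turns the moments of the coordinates into one of the squared
    norm, and the sum over the blocks is at most [2 #|I|]. *)
Lemma signed_sum_small_blocks (R : realType) (n : nat) (I : finType)
    (S : I -> {set 'I_n}) (s : seq 'cV[R]_n) (o : 'I_n -> R) :
  (forall j, 0 < o j) -> (forall j, \sum_(w <- s) w j 0 ^+ 2 <= 2 * o j) ->
  exists2 x, signed_sums 0 s x &
    forall k, \sum_(j in S k) x j 0 ^+ 2
      <= 32 * ln (2 * #|I|%:R) * \sum_(j in S k) o j.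
Proof.
move=> o0 so; pose O k := \sum_(j in S k) o j.
have O0 k : 0 <= O k by apply: sumr_ge0 => j _; exact: ltW.
pose p j := \sum_(k | j \in S k) 32 * o j ^+ 2 / O k.
pose u j := 32 * o j - 8 * \sum_(w <- s) w j 0 ^+ 2.
have u16 j : 16 * o j <= u j by rewrite /u; have := so j; lra.
have u0 j : 0 < u j by apply: lt_le_trans (u16 j); rewrite mulr_gt0.
have p0 j : 0 <= p j.
  by apply: sumr_ge0 => k _; rewrite divr_ge0// mulr_ge0// sqr_ge0.
(* the weights p j make block k contribute the average of the exponentials of
   its coordinates, with weights o j / O k *)
have [x xs xP] := signed_sum_small_estimators s 0 p0 u0; exists x => // k.
have xE : \sum_j p j * estimator (u j + 8 * \sum_(w <- s) w j 0 ^+ 2) (x j 0) =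
    \sum_k \sum_(j in S k) o j / O k * expR (x j 0 ^+ 2 / (32 * o j)).
  rewrite (exchange_big_dep xpredT)//=; apply: eq_bigr => j _.
  rewrite mulr_suml; apply: eq_bigr => l _.
  rewrite /u subrK /estimator mulrA; congr (_ * _).
  by rewrite mulrAC; congr (_ / _); field; rewrite gt_eqF.
have le2 : \sum_j p j * estimator (u j) ((0 : 'cV[R]_n) j 0) <= 2 * #|I|%:R.
  apply: (@le_trans _ _ (\sum_j p j * (16 * o j)^-1)).
    apply: ler_sum => j _; rewrite ler_wpM2l// /estimator mxE expr0n mul0r expR0.
    by rewrite mulr1 lef_pV2 ?posrE// mulr_gt0.
  under eq_bigr => j _ do rewrite mulr_suml.
  rewrite (exchange_big_dep xpredT)//= -sum1_card natr_sum mulr_sumr.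
  apply: ler_sum => l _.
  rewrite (eq_bigr (fun j => 2 / O l * o j)) => [|j _]; last first.
    have -> : 32 * o j ^+ 2 / O l / (16 * o j) = 32 * o j ^+ 2 / (16 * o j) / O l.
      by rewrite mulrAC.
    rewrite [RHS]mulrAC; congr (_ / _); field; exact/lt0r_neq0.
  rewrite -mulr_sumr -/(O l) mulr1; have [->|Ol] := eqVneq (O l) 0.
    by rewrite mulr0.
  by rewrite divfK.
have [Ok|Ok] := eqVneq (O k) 0.
  rewrite big1 ?/O -/(O k) ?Ok ?mulr0// => j jS.
  move: Ok => /eqP; rewrite psumr_eq0 => [/allP/(_ j)|i _]; last exact: ltW.
  by rewrite mem_index_enum jS gt_eqF// => /(_ isT).
have Okp : 0 < O k by rewrite lt_neqAle eq_sym Ok O0.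
have : expR ((\sum_(j in S k) x j 0 ^+ 2) / (32 * O k)) <= 2 * #|I|%:R.
  apply: le_trans le2; apply: le_trans xP; rewrite xE (bigD1 k)//=.
  apply: (@le_trans _ _ (\sum_(j in S k) o j / O k * expR (x j 0 ^+ 2 / (32 * o j)))).
    have -> : (\sum_(j in S k) x j 0 ^+ 2) / (32 * O k) =
        \sum_(j in S k) o j / O k * (x j 0 ^+ 2 / (32 * o j)).
      by rewrite mulr_suml; apply: eq_bigr => j _; field; rewrite Ok gt_eqF.
    apply: expR_jensen => [j|]; first by rewrite divr_ge0// ltW.
    by rewrite -mulr_suml divff.
  rewrite lerDl; apply: sumr_ge0 => l _; apply: sumr_ge0 => j _.
  by rewrite mulr_ge0 ?expR_ge0// divr_ge0// ltW.
have I0 : 0 < 2 * #|I|%:R :> R by rewrite mulr_gt0// ltr0n; apply/card_gt0P; exists k.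
rewrite -[leRHS]lnK ?posrE// ler_expR ler_pdivrMr ?mulr_gt0//.
by rewrite mulrA [ln _ * _]mulrC.
Qed.

(** The columns of Z are first rotated so as to become B-orthogonal, which changes
    neither Z Z^T nor the traces, then given nonnegative i0-th coordinates by
    changing signs, sorted by these coordinates, and signed in pairs. *)
Lemma psd_rounding (R : realType) (n p : nat) (I : finType) (B : 'M[R]_n)
    (Z : 'M[R]_(n, p)) (i0 : 'I_n) (S : I -> {set 'I_n}) (o : 'I_n -> R) :
  B^T = B -> (forall j, 0 < o j) -> (forall j, (Z *m Z^T) j j <= o j) ->
  exists x : 'cV[R]_n,
    [/\ x i0 0 ^+ 2 <= (Z *m Z^T) i0 i0,
        bilin B x x = \tr (B *m (Z *m Z^T))
      & forall k, \sum_(j in S k) x j 0 ^+ 2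
          <= 32 * ln (2 * #|I|%:R) * \sum_(j in S k) o j].
Proof.
move=> BT o0 Zo.
have [|P PP Pd] := @symmetric_orthogonally_diagonalizable _ _ (Z^T *m B *m Z).
  by rewrite !trmx_mul trmxK BT mulmxA.
pose Y := Z *m P^T.
have PtP : P^T *m P = 1%:M by exact: mulmx1C.
have YY : Y *m Y^T = Z *m Z^T.
  by rewrite /Y trmx_mul trmxK mulmxA -(mulmxA Z) PtP mulmx1.
have Yd i j : i != j -> (Y^T *m B *m Y) i j = 0.
  move=> ij; have /is_diag_mxP/(_ i j ij) := Pd.
  by rewrite /Y trmx_mul trmxK !mulmxA.
pose y i := if 0 <= Y i0 i then col i Y else - col i Y.
have y0 i : 0 <= y i i0 0.
  by rewrite /y; case: ifPn; rewrite !mxE// -ltNge oppr_ge0 => /ltW.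
have ysq i j : y i j 0 ^+ 2 = Y j i ^+ 2.
  by rewrite /y; case: ifP; rewrite !mxE// sqrrN.
have ycol i j : bilin B (col i Y) (col j Y) = (Y^T *m B *m Y) i j.
  by rewrite /bilin tr_col -!row_mul [col j Y]colE mulmxA -colE mxE [LHS]mxE.
have yB i : bilin B (y i) (y i) = (Y^T *m B *m Y) i i.
  by rewrite /y; case: ifP; rewrite ?bilinNN ycol.
have yort i j : i != j -> bilin B (y i) (y j) = 0.
  move=> ij; have N a b : bilin B a b = 0 ->
      [/\ bilin B (- a) b = 0, bilin B a (- b) = 0 & bilin B (- a) (- b) = 0].
    move=> ab; rewrite bilinNN bilinNl ab oppr0; split=> //.
    by rewrite bilinC// bilinNl bilinC// ab oppr0.
  have cij : bilin B (col i Y) (col j Y) = 0 by rewrite ycol Yd.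
  have [] := N _ _ cij; move: cij.
  by rewrite /y; case: ifP; case: ifP.
pose r := relpre (fun i => y i i0 0) (>=%R : rel R).
pose s := sort r (enum 'I_p).
have sums (F : 'cV[R]_n -> R) : \sum_(z <- map y s) F z = \sum_i F (y i).
  by rewrite big_map (perm_big _ (permEl (perm_sort _ _))) big_enum.
have sumsq j : \sum_(z <- map y s) z j 0 ^+ 2 = (Z *m Z^T) j j.
  rewrite sums -YY mxE; apply: eq_bigr => i _.
  by rewrite ysq [Y^T _ _]mxE expr2.
have coordB j : {morph (fun z : 'cV[R]_n => z j 0) : v w / v - w}.
  by move=> v w /=; rewrite !mxE.
have coordD j : {morph (fun z : 'cV[R]_n => z j 0) : v w / v + w}.
  by move=> v w /=; rewrite mxE.
have [|x xs xS] := @signed_sum_small_blocks _ n I S (pair_diffs (map y s)) o o0.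
  move=> j; apply: le_trans (pair_diffs_sqr _ (coordB j)) _.
  by rewrite ler_pM2l// sumsq.
exists x; split => //.
- pose m := Num.sqrt ((Z *m Z^T) i0 i0).
  have Z0 : 0 <= (Z *m Z^T) i0 i0.
    by rewrite -sumsq; apply: sumr_ge0 => z _; exact: sqr_ge0.
  have m0 : 0 <= m by exact: sqrtr_ge0.
  have ym i : y i i0 0 <= m.
    rewrite -[leLHS]ger0_norm// -sqrtr_sqr ler_wsqrtr// -sumsq sums.
    by rewrite (bigD1 i)//= lerDl; apply: sumr_ge0 => k _; exact: sqr_ge0.
  have : `|x i0 0| <= m.
    have /le_trans := signed_sums_norm (coordD i0) (coordB i0) xs; apply.
    rewrite mxE normr0 add0r; apply: (pair_diffs_telescope (coordB i0)) => //.
    - rewrite -map_comp path_min_sorted; last by apply/allP => _ /mapP[i _ ->] /=.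
      rewrite sorted_map; apply: sort_sorted => i j /=.
      exact: le_total.
    - by rewrite all_map; apply/allP => i _ /=.
  rewrite -(ler_pXn2r (n := 2))// ?nnegrE//.
  by rewrite real_normK ?num_real// sqr_sqrtr.
- have := signed_sums_pair_diffs xs => /(bilin_signed_sums BT) ->.
  + rewrite sums /bilin trmx0 !mul0mx mxE add0r -YY mulmxA mxtrace_mulC mulmxA.
    by apply: eq_bigr => i _; exact: yB.
  + by apply/allP => z _; rewrite /bilin trmx0 !mul0mx mxE.
  + rewrite pairwise_map; have : uniq s by rewrite sort_uniq enum_uniq.
    rewrite uniq_pairwise; apply: sub_pairwise => i j /= ij.
    by rewrite yort.
Qed.

(** * The approximate S-lemma *)

Lemma sum_option (R : realType) (I : finType) (F : option I -> R) :
  \sum_k F k = F None + \sum_i F (Some i).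
Proof.
rewrite (bigD1 None)//=; congr (_ + _).
rewrite (reindex_omap Some id) => [|[]//].
by apply: eq_bigl => i; rewrite eqxx.
Qed.

(** If the multipliers do not exist, then some X = Z Z^T satisfies
    [tr (B X) > c tr_k X] for every block k, the leading coordinate included.
    Let M be slightly above the largest of these traces.  Rounding X and
    dividing by the square root of M gives a point that satisfies the
    constraints, and where q is [tr (B X) / M > c]. *)
Lemma approximate_S_lemma (R : realType) (n : nat) (I : finType) (B : 'M[R]_n)
    (i0 : 'I_n) (S : I -> {set 'I_n}) (c : R) :
  B^T = B -> 0 <= c ->
  (forall x : 'cV[R]_n, x i0 0 ^+ 2 <= 1 ->
    (forall k, \sum_(j in S k) x j 0 ^+ 2 <= 32 * ln (2 * #|I|%:R)) ->
    bilin B x x <= c) ->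
  exists l : option I -> R,
    [/\ forall k, 0 <= l k, \sum_k l k = c
      & forall x : 'cV[R]_n, bilin B x x <= l None * x i0 0 ^+ 2
          + \sum_k l (Some k) * \sum_(j in S k) x j 0 ^+ 2].
Proof.
move=> BT c0 H.
pose S' k := if k is Some k' then S k' else [set i0]%SET.
pose tau (X : 'M[R]_n) k := \sum_(j in S' k) X j j.
pose v k (X : 'M[R]_n) := \tr (B *m X) - c * tau X k.
pose C := [set X : 'M[R]_n | exists (p : nat) (Z : 'M[R]_(n, p)), X = Z *m Z^T].
have [| | | | | |l [l0 l1] lP] := @cone_alternative _ _ (option I) v C.
- by apply/card_gt0P; exists None.
- move=> _ _ [p1 [Z1 ->]] [p2 [Z2 ->]]; exists (p1 + p2)%N, (row_mx Z1 Z2).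
  by rewrite tr_row_mx mul_row_col.
- move=> a _ a0 [p [Z ->]]; exists p, (Num.sqrt a *: Z).
  by rewrite linearZ/= -scalemxAl -scalemxAr scalerA -expr2 sqr_sqrtr// ltW.
- move=> k X Y; rewrite /v /tau mulmxDr mxtraceD.
  by under eq_bigr => j _ do rewrite mxE; rewrite big_split/=; ring.
- move=> k a X; rewrite /v /tau -scalemxAr mxtraceZ.
  by under eq_bigr => j _ do rewrite mxE; rewrite -mulr_sumr; ring.
- move=> _ [p [Z ->]]; apply: contrapT => /forallNP nv.
  set X := Z *m Z^T in nv; set t := \tr (B *m X).
  have X0 j : 0 <= X j j.
    by rewrite mxE; apply: sumr_ge0 => i _; rewrite [Z^T _ _]mxE -expr2 sqr_ge0.
  have tau0 k : 0 <= tau X k by apply: sumr_ge0.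
  have [k0 tau_max] : exists k0, forall k, tau X k <= tau X k0.
    case: (@arg_maxP _ _ _ None xpredT (tau X)) => // k0 _ k0P.
    by exists k0 => k; exact: k0P.
  have ct : 0 < t - c * tau X k0 by have /negP := nv k0; rewrite -ltNge.
  have c1 : 0 < c + 1 by lra.
  (* the margin d keeps M and all the bounds o j positive, even when X vanishes
     on the blocks, and is small enough for c * M < t *)
  pose d := (t - c * tau X k0) / (c + 1).
  have d0 : 0 < d by rewrite divr_gt0.
  pose M := tau X k0 + d.
  have M0 : 0 < M by rewrite ltr_wpDl.
  have cM : c * M < t.
    rewrite -subr_gt0 /M; have -> : t - c * (tau X k0 + d) = d.
      by rewrite /d; field; rewrite gt_eqF.
    exact: d0.
  have n0 : (0 < n)%N by case: (i0) => i; case: (n).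
  pose o j := X j j + d / n%:R.
  have dn : 0 < d / n%:R by rewrite divr_gt0// ltr0n.
  have [//|j|j|x [x1 x2 x3]] := @psd_rounding _ n p I B Z i0 S o.
  + by rewrite ltr_wpDl.
  + by rewrite lerDl ltW.
  have oM k : \sum_(j in S k) o j <= M.
    rewrite big_split/= lerD ?(tau_max (Some k))// sumr_const -[leLHS]mulr_natr.
    rewrite mulrAC ler_pdivrMr ?ltr0n// ler_wpM2l ?(ltW d0)// ler_nat.
    by apply: leq_trans (max_card _) _; rewrite card_ord.
  have := H ((Num.sqrt M)^-1 *: x).
  have sM a : ((Num.sqrt M)^-1 * a) ^+ 2 = a ^+ 2 / M.
    by rewrite exprMn exprVn sqr_sqrtr ?(ltW M0)// mulrC.
  have -> : bilin B ((Num.sqrt M)^-1 *: x) ((Num.sqrt M)^-1 *: x) = t / M.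
    by rewrite bilinZZ exprVn sqr_sqrtr ?(ltW M0)// x2 mulrC.
  move=> Hx; suff : t / M <= c by rewrite ler_pdivrMr// leNgt cM.
  apply: Hx.
    rewrite mxE sM ler_pdivrMr// mul1r; apply: le_trans x1 _.
    have := tau_max None; rewrite {1}/tau big_set1 => /le_trans; apply.
    by rewrite lerDl ltW.
  move=> k; under eq_bigr => j _ do rewrite mxE sM.
  rewrite -mulr_suml ler_pdivrMr//; apply: le_trans (x3 k) _.
  rewrite ler_wpM2l// mulr_ge0// ln_ge0// -natrM ler1n muln_gt0/=.
  by apply/card_gt0P; exists k.
exists (fun k => c * l k); split=> [k||x].
- by rewrite mulr_ge0.
- by rewrite -mulr_sumr l1 mulr1.
have := lP (x *m x^T) (ex_intro _ 1%N (ex_intro _ x erefl)).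
have xx j : (x *m x^T) j j = x j 0 ^+ 2 by rewrite mxE big_ord1 [x^T _ _]mxE.
have trx : \tr (B *m (x *m x^T)) = bilin B x x.
  by rewrite mulmxA mxtrace_mulC mulmxA trace_mx11.
under eq_bigr => k _ do rewrite /v trx mulrBr mulrCA mulrA.
rewrite sumrB -mulr_suml l1 mul1r subr_le0 => /le_trans; apply.
rewrite sum_option /tau/= big_set1 xx lerD2l.
by apply: ler_sum => k _; under eq_bigr => j _ do rewrite xx.
Qed.

(** * The constraints of the two problems as quadratic forms *)

Lemma enorm_le (R : realType) (k : nat) (x : 'cV[R]_k) (r : R) :
  0 <= r -> (enorm x <= r) = (\sum_i x i 0 ^+ 2 <= r ^+ 2).
Proof.
move=> r0; rewrite /enorm -[in LHS](ger0_norm r0) -sqrtr_sqr.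
by rewrite ler_sqrt// sqr_ge0.
Qed.

Lemma zeta_atE (R : realType) (T : nat) (zeta : 'cV[R]_(T * Nu)) (t : 'I_T)
    (a : 'I_Nu) :
  zeta_at zeta t a 0 = zeta (mxvec_index t a) 0.
Proof. by rewrite !mxE. Qed.

Lemma bilin_diag (R : realType) (n : nat) (d : 'rV[R]_n) (x : 'cV[R]_n) :
  bilin (diag_mx d) x x = \sum_j d 0 j * x j 0 ^+ 2.
Proof.
rewrite /bilin mul_mx_diag mxE; apply: eq_bigr => j _.
by rewrite !mxE expr2; ring.
Qed.

Lemma bilin_block (R : realType) (n1 n2 : nat) (A : 'M[R]_n1) (B : 'M[R]_(n1, n2))
    (C : 'M[R]_(n2, n1)) (D : 'M[R]_n2) (x : 'cV[R]_n1) (y : 'cV[R]_n2) :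
  bilin (block_mx A B C D) (col_mx x y) (col_mx x y) =
  bilin A x x + (x^T *m B *m y) 0 0 + (y^T *m C *m x) 0 0 + bilin D y y.
Proof.
rewrite /bilin tr_col_mx mul_row_block mul_row_col !mulmxDl.
by rewrite mxE [X in X + _]mxE [X in _ + X]mxE; ring.
Qed.

Lemma bilin_homogenized (R : realType) (n : nat) (r : 'rV[R]_n) (Q : 'M[R]_n)
    (a : 'cV[R]_1) (x : 'cV[R]_n) :
  bilin (block_mx 0 r r^T Q) (col_mx a x) (col_mx a x) =
  2 * a 0 0 * (r *m x) 0 0 + bilin Q x x.
Proof.
rewrite bilin_block {1}/bilin mulmx0 mul0mx mxE add0r; congr (_ + _).
rewrite -trmx_mul [a]mx11_scalar tr_scalar_mx mul_scalar_mx mul_mx_scalar.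
rewrite -scalemxAl [X in X + _]mxE [X in _ + X]mxE [X in _ + _ * X]mxE.
by rewrite [_%:M _ _]mxE eqxx mulr1n; ring.
Qed.

Lemma bilinB (R : realType) (n : nat) (A B : 'M[R]_n) (x : 'cV[R]_n) :
  bilin (A - B) x x = bilin A x x - bilin B x x.
Proof. by rewrite /bilin mulmxBr mulmxBl [LHS]mxE [X in _ + X]mxE. Qed.

(** The index sets of xi ([None]) and of zeta_t ([Some t]) in the homogenized
    vector (1, xi, zeta). *)
Definition uncertainty_block (T : nat) (k : option 'I_T) :
    {set 'I_(1 + (T + T * Nu))} :=
  if k is Some t
  then [set rshift 1 (rshift T (mxvec_index t a)) | a in 'I_Nu]%SET
  else [set rshift 1 (lshift (T * Nu) j) | j in 'I_T]%SET.

Lemma sum_uncertainty_block (R : realType) (T : nat) (a : 'cV[R]_1)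
    (xi : 'cV[R]_T) (zeta : 'cV[R]_(T * Nu)) (k : option 'I_T) :
  \sum_(j in uncertainty_block k) (col_mx a (col_mx xi zeta)) j 0 ^+ 2 =
  if k is Some t then \sum_b zeta_at zeta t b 0 ^+ 2 else \sum_j xi j 0 ^+ 2.
Proof.
case: k => [t|] /=; rewrite big_imset/=.
- by apply: eq_bigr => b _; rewrite !col_mxEd zeta_atE.
- move=> b1 b2 _ _ /rshift_inj/rshift_inj e.
  have := congr1 (enum_val \o cast_ord (esym (mxvec_cast T Nu))) e.
  by rewrite /= !cast_ordK !enum_rankK => -[].
- by apply: eq_bigr => j _; rewrite col_mxEd col_mxEu.
- by move=> j1 j2 _ _ /rshift_inj/lshift_inj.
Qed.

Lemma bilin_multipliers (R : realType) (T m : nat) (lam : 'M[R]_(T.+2, m))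
    (i : 'I_m) (a : 'cV[R]_1) (xi : 'cV[R]_T) (zeta : 'cV[R]_(T * Nu)) :
  bilin (block_mx (lam ord0 i)%:M 0 0 (Jmx lam i))
    (col_mx a (col_mx xi zeta)) (col_mx a (col_mx xi zeta)) =
  lam ord0 i * a 0 0 ^+ 2 + lam (inord 1) i * \sum_j xi j 0 ^+ 2
  + \sum_(t < T) lam (inord t.+2) i * \sum_b zeta_at zeta t b 0 ^+ 2.
Proof.
rewrite /Jmx !bilin_block !mulmx0 !mul0mx mxE !addr0 -!diag_const_mx !bilin_diag.
rewrite big_ord1 mxE addrA; congr (_ + _ + _).
  by rewrite mulr_sumr; apply: eq_bigr => j _; rewrite mxE.
under [RHS]eq_bigr => t _ do rewrite mulr_sumr.
rewrite (reindex _ (curry_mxvec_bij _ _)) pair_bigA; apply: eq_bigr => -[t b] _ /=.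
by rewrite mxvecE mxE zeta_atE.
Qed.

Lemma sum_multipliers (R : realType) (T m : nat) (lam : 'M[R]_(T.+2, m)) (i : 'I_m) :
  \sum_l lam l i =
  lam ord0 i + lam (inord 1) i + \sum_(t < T) lam (inord t.+2) i.
Proof.
rewrite big_ord_recl big_ord_recl addrA; congr (_ + lam _ i + _).
  by apply/val_inj; rewrite /= inordK.
apply: eq_bigr => t _; congr (lam _ i); apply/val_inj.
by rewrite /= inordK// !ltnS.
Qed.

Lemma policy_constraintE (R : realType) (T m k : nat)
    (W1 : 'M[R]_(m, T)) (W2 : 'M[R]_(m, k)) (Dt : 'M[R]_T)
    (Theta : 'M[R]_(m, T * Nu)) (nu : 'cV[R]_m) (E : 'M[R]_T) (e : 'cV[R]_T)
    (p : policy R (T + T * Nu) k) (xi : 'cV[R]_T) (zeta : 'cV[R]_(T * Nu))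
    (i : 'I_m) :
  let eta := col_mx xi zeta in
  (W1 *m invmx Dt *m (E *m xi + e) + W2 *m policy_eval p eta) i 0
    - (Theta *m zeta + nu) i 0 =
  2 * (rho W1 W2 Dt Theta E (pol_L p) i *m eta) 0 0
  + bilin (\sum_j W2 i j *: pol_Q p j) eta eta
  + ((row i W1 *m invmx Dt *m e) 0 0 + (row i W2 *m pol_c p) 0 0 - nu i 0).
Proof.
move=> eta.
have rowE (q : nat) (M : 'M[R]_(m, q)) (N : 'M[R]_(q, 1)) :
    (row i M *m N) 0 0 = (M *m N) i 0 by rewrite -row_mul mxE.
have qE : bilin (\sum_j W2 i j *: pol_Q p j) eta eta =
    (W2 *m \col_j (eta^T *m pol_Q p j *m eta) 0 0) i 0.
  rewrite /bilin mulmx_sumr mulmx_suml summxE [RHS]mxE; apply: eq_bigr => j _.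
  by rewrite -scalemxAr -scalemxAl [LHS]mxE [X in _ = _ * X]mxE.
have rE : 2 * (rho W1 W2 Dt Theta E (pol_L p) i *m eta) 0 0 =
    (W1 *m invmx Dt *m (E *m xi)) i 0 - (Theta *m zeta) i 0
    + (W2 *m (pol_L p *m eta)) i 0.
  rewrite /rho -scalemxAl [X in 2 * X]mxE mulVKf ?pnatr_eq0// mulmxDl [LHS]mxE.
  congr (_ + _); last by rewrite -mulmxA rowE.
  rewrite /eta mul_row_col mulNmx [LHS]mxE [X in _ + X]mxE rowE.
  by rewrite -!row_mul -mulmxA mxE.
rewrite rE qE -row_mul !rowE /policy_eval !mulmxDr.
have addE (M N : 'cV[R]_m) : (M + N) i 0 = M i 0 + N i 0 by rewrite mxE.
rewrite !addE.
by ring.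
Qed.

(** * The two inclusions *)

Lemma sdp_sub_quad_policy (R : realType) (T m k : nat)
    (W1 : 'M[R]_(m, T)) (W2 : 'M[R]_(m, k)) (Dt : 'M[R]_T)
    (Theta : 'M[R]_(m, T * Nu)) (nu : 'cV[R]_m) :
  proj_Ee (sdp_problem W1 W2 Dt Theta nu)
  `<=` proj_Ee (quad_policy_problem W1 W2 Dt Theta nu 1).
Proof.
move=> _ [[[E e] [p lam]] [Epsd psym H] <-].
exists ((E, e), p) => //; split=> // xi zeta xi1 zeta1 i.
have [sum_le [_ quad_ge0] lam0] := H i.
rewrite -subr_le0 policy_constraintE.
have := quad_ge0 (col_mx 1%:M (col_mx xi zeta)); rewrite -/(bilin _ _ _) bilinB.
rewrite bilin_multipliers bilin_homogenized mxE eqxx expr1n !mulr1.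
move: xi1; rewrite enorm_le// expr1n => xi1.
have {}zeta1 t : \sum_b zeta_at zeta t b 0 ^+ 2 <= 1.
  by have := zeta1 t; rewrite enorm_le// expr1n.
have le1 : lam (inord 1) i * \sum_j xi j 0 ^+ 2 <= lam (inord 1) i.
  by rewrite ler_piMr.
have le2 : \sum_(t < T) lam (inord t.+2) i * \sum_b zeta_at zeta t b 0 ^+ 2
    <= \sum_(t < T) lam (inord t.+2) i.
  by apply: ler_sum => t _; rewrite ler_piMr.
move: sum_le; rewrite sum_multipliers; lra.
Qed.

(** Row 0 of the multipliers belongs to the leading coordinate ([None]), row 1 to
    xi ([Some None]) and row t + 2 to zeta_t ([Some (Some t)]). *)
Definition multiplier_block (T : nat) (l : 'I_T.+2) : option (option 'I_T) :=
  omap (unlift ord0) (unlift ord0 l).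

Lemma multiplier_block0 (T : nat) : multiplier_block (ord0 : 'I_T.+2) = None.
Proof. by rewrite /multiplier_block unlift_none. Qed.

Lemma multiplier_block1 (T : nat) :
  multiplier_block (inord 1 : 'I_T.+2) = Some None.
Proof.
have -> : inord 1 = lift ord0 ord0 :> 'I_T.+2 by apply/val_inj; rewrite /= inordK.
by rewrite /multiplier_block liftK/= unlift_none.
Qed.

Lemma multiplier_block2 (T : nat) (t : 'I_T) :
  multiplier_block (inord t.+2 : 'I_T.+2) = Some (Some t).
Proof.
have -> : inord t.+2 = lift ord0 (lift ord0 t) :> 'I_T.+2.
  by apply/val_inj; rewrite /= inordK// !ltnS.
by rewrite /multiplier_block liftK/= liftK.
Qed.

Lemma ln_double_le (R : realType) (T : nat) : (0 < T)%N ->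
  32 * ln (2 * T.+1%:R) <= (919 / 100 * Num.sqrt (ln T.+1%:R)) ^+ 2 :> R.
Proof.
move=> T0; have T1 : 0 < T.+1%:R :> R by rewrite ltr0n.
have ln0 : 0 <= ln T.+1%:R :> R by rewrite ln_ge0// ler1n.
rewrite exprMn sqr_sqrtr// lnM ?posrE//.
have : ln 2 <= ln T.+1%:R :> R by rewrite ler_ln ?posrE// ler_nat.
lra.
Qed.

(** The S-lemma is applied to each row; that the bound c is nonnegative, as it
    requires, is the robust constraint at eta = 0. *)
Lemma quad_policy_sub_sdp (R : realType) (T m k : nat)
    (W1 : 'M[R]_(m, T)) (W2 : 'M[R]_(m, k)) (Dt : 'M[R]_T)
    (Theta : 'M[R]_(m, T * Nu)) (nu : 'cV[R]_m) (r : R) :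
  0 <= r -> 32 * ln (2 * T.+1%:R) <= r ^+ 2 ->
  proj_Ee (quad_policy_problem W1 W2 Dt Theta nu r)
  `<=` proj_Ee (sdp_problem W1 W2 Dt Theta nu).
Proof.
move=> r0 r2 _ [[[E e] p] [Epsd psym H] <-].
pose rh i := rho W1 W2 Dt Theta E (pol_L p) i.
pose Q i := \sum_(j < k) W2 i j *: pol_Q p j.
pose B i : 'M[R]_(1 + (T + T * Nu)) := block_mx 0 (rh i) (rh i)^T (Q i).
pose c i := - ((row i W1 *m invmx Dt *m e) 0 0 + (row i W2 *m pol_c p) 0 0 - nu i 0).
have QT i : (Q i)^T = Q i.
  rewrite /Q linear_sum/=; apply: eq_bigr => j _.
  by rewrite linearZ/= psym.
have BT i : (B i)^T = B i by rewrite /B tr_block_mx trmx0 trmxK QT.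
have feas i (xi : 'cV[R]_T) (zeta : 'cV[R]_(T * Nu)) :
    \sum_j xi j 0 ^+ 2 <= r ^+ 2 ->
    (forall t, \sum_b zeta_at zeta t b 0 ^+ 2 <= r ^+ 2) ->
    2 * (rh i *m col_mx xi zeta) 0 0
      + bilin (Q i) (col_mx xi zeta) (col_mx xi zeta) <= c i.
  move=> hxi hzeta; rewrite -subr_le0 opprK -policy_constraintE subr_le0.
  by apply: H => [|t]; rewrite enorm_le.
have c0 i : 0 <= c i.
  have := feas i 0 0; rewrite col_mx0 mulmx0 mxE mulr0 add0r /bilin mulmx0 mxE.
  apply; first by rewrite big1 ?sqr_ge0// => j _; rewrite mxE expr0n.
  by move=> t; rewrite big1 ?sqr_ge0// => b _; rewrite zeta_atE mxE expr0n.
have mult i : exists l : option (option 'I_T) -> R,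
    [/\ forall k, 0 <= l k, \sum_k l k = c i
      & forall x : 'cV[R]_(1 + (T + T * Nu)),
          bilin (B i) x x <= l None * x (lshift _ ord0) 0 ^+ 2
          + \sum_k l (Some k) * \sum_(j in uncertainty_block k) x j 0 ^+ 2].
  apply: approximate_S_lemma => // x; rewrite card_option card_ord.
  rewrite -[x]vsubmxK; move: (usubmx x) (dsubmx x) => a eta.
  rewrite -[eta]vsubmxK; move: (usubmx eta) (dsubmx eta) => xi zeta.
  rewrite col_mxEu => a1 hx.
  have hxi : \sum_j xi j 0 ^+ 2 <= r ^+ 2.
    by apply: le_trans r2; have := hx None; rewrite sum_uncertainty_block.
  have hzeta t : \sum_b zeta_at zeta t b 0 ^+ 2 <= r ^+ 2.
    by apply: le_trans r2; have := hx (Some t); rewrite sum_uncertainty_block.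
  have := feas i xi zeta hxi hzeta.
  have := feas i (- xi) (- zeta); rewrite -opp_col_mx bilinNN mulmxN [X in 2 * X]mxE.
  rewrite bilin_homogenized => /(_ _ _) feasN feasP.
  have {}feasN : 2 * - (rh i *m col_mx xi zeta) 0 0
      + bilin (Q i) (col_mx xi zeta) (col_mx xi zeta) <= c i.
    apply: feasN.
      by under eq_bigr => j _ do rewrite mxE sqrrN.
    move=> t; under eq_bigr => b _ do rewrite zeta_atE mxE sqrrN -zeta_atE.
    exact: hzeta.
  move: (_ 0 0) (bilin _ _ _) (a 0 0) a1 feasN feasP => b q a' a1 feasN feasP.
  (* q is affine in the leading coordinate, so it is enough to bound it at the
     ends 1 and -1, and the latter is the value of q(1, -eta) *)
  have : -1 <= a' <= 1 by apply/andP; split; nra.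
  by move=> /andP[]; nra.
have [l lP] := choice mult.
pose lam : 'M[R]_(T.+2, m) := \matrix_(j, i) l i (multiplier_block j).
have lamE : ((forall i, lam ord0 i = l i None)
    * (forall i, lam (inord 1) i = l i (Some None))
    * (forall t i, lam (inord (t : 'I_T).+2) i = l i (Some (Some t))))%type.
  by split; [split|] => *; rewrite mxE
    (multiplier_block0, multiplier_block1, multiplier_block2).
exists ((E, e), (p, lam)) => //; split=> // i; have [l0 lsum lq] := lP i.
split.
- rewrite sum_multipliers !lamE; under eq_bigr => t _ do rewrite lamE.
  by move: lsum; rewrite !sum_option /c; lra.
- split.
    rewrite linearB/= !tr_block_mx !trmx0 tr_scalar_mx trmxK QT.
    by rewrite tr_scalar_mx tr_diag_mx.
  move=> x; rewrite -/(bilin _ _ _) bilinB subr_ge0.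
  apply: le_trans (lq x) _.
  rewrite -[x]vsubmxK -[dsubmx x]vsubmxK bilin_multipliers !lamE col_mxEu.
  rewrite sum_option !sum_uncertainty_block -addrA lerD2l lerD2l.
  by apply: ler_sum => t _; rewrite sum_uncertainty_block lamE.
- by move=> j; rewrite mxE.
Qed.

Theorem theorem1 (R : realType) (T n m : nat)
  (T_gt0 : (0 < T)%N) (n_gt0 : (0 < n)%N) (m_gt0 : (0 < m)%N)
  (W : 'M[R]_(m, n * T)) (D : 'M[R]_(T, n * T))
  (* the time to which each of the nT columns corresponds, n columns per time *)
  (time : 'I_(n * T) -> 'I_T)
  (time_card : forall t : 'I_T, #|[set c | time c == t]%SET| = n)
  (D_supp : forall (t : 'I_T) (c : 'I_(n * T)), D t c != 0 -> time c = t)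
  (D_rank : \rank D = T)
  (z : 'cV[R]_(T * Nu) -> 'cV[R]_m) (z_affine : affine_map z)
  (b : 'cV[R]_(T * Nu) -> 'cV[R]_T) (b_affine : affine_map b)
  (* the columns of B are b^1, ..., b^{nT}, with nT = T + (n-1)T *)
  (B : 'M[R]_(n * T, T + n.-1 * T))
  (B_basis : row_free B^T /\ row_full B^T)
  (B_orthogonal : forall j l, j != l -> ((col j B)^T *m col l B) 0 0 = 0)
  (B_null : ((rsubmx B)^T :=: kermx D^T)%MS)
  (Theta : 'M[R]_(m, T * Nu)) (nu : 'cV[R]_m) :
  let W1 := W *m lsubmx B in
  let W2 := W *m rsubmx B in
  let Dt := D *m lsubmx B in
  (forall zeta, z zeta + W1 *m invmx Dt *m b zeta = Theta *m zeta + nu) ->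
  let F r := proj_Ee (quad_policy_problem W1 W2 Dt Theta nu r) in
  let S := proj_Ee (sdp_problem W1 W2 Dt Theta nu) in
  F (919 / 100 * Num.sqrt (ln T.+1%:R)) `<=` S /\ S `<=` F 1.

Proof.
move=> W1 W2 Dt _ F S; split; last exact: sdp_sub_quad_policy.
apply: quad_policy_sub_sdp; last exact: ln_double_le.
by rewrite mulr_ge0// sqrtr_ge0.
Qed.
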